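(* Let $T_1=(\mathcal{L},\mathcal{R}_1)$ and $T_2=(\mathcal{L},\mathcal{R}_2)$ be graph transformation systems over a common label alphabet. Then $T_1\cong T_2\Rightarrow T_1\simeq_N T_2\Rightarrow T_1\simeq_S T_2\Rightarrow T_1\simeq_F T_2$. Moreover, each of these inclusions is strict in general: none of the three converse implications holds for all pairs of systems.
   Context: Fix a label alphabet $\mathcal{L}=(\mathcal{L}_V,\mathcal{L}_E)$ of finite sets. A graph over $\mathcal{L}$ is $G=(V,E,s,t,l,m,p)$ with finite $V,E$, total $s,t:E\to V$, partial node labelling $l:V\to\mathcal{L}_V$, total edge labelling $m:E\to\mathcal{L}_E$, partial rootedness $p:V\to\{0,1\}$. A TLRG has $l,p$ total. Morphisms preserve sources, targets, edge labels, and node labels and rootedness where defined in the domain; isomorphisms are bijective morphisms whose inverse is a morphism. $K$ is a subgraph of $G$ iff $V_K\subseteq V_G$, $E_K\subseteq E_G$, structure and edge labels restrict, $l_K\subseteq l_G$, $p_K\subseteq p_G$. A rule $\langle L\leftarrow K\rightarrow R\rangle$: TLRGs $L,R$ and a graph $K$ that is a subgraph of both. Rule application to a TLRG $G$ via an injective $g:L\to G$ satisfying the dangling condition (no edge outside $g(L)$ incident to $g(V_L\setminus V_K)$): delete images of $L\setminus K$, make $g_V(v)$ unlabelled / of undefined rootedness when $v\in V_K$ is so in $K$; add disjointly $R\setminus K$ with labels and rootedness, and give such $g_V(v)$ the label $l_R(v)$ / rootedness $p_R(v)$; result $H$; $G\Rightarrow_r M$ iff $M\cong H$ for some match. A GT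 system $T=(\mathcal{L},\mathcal{R})$ has a finite set $\mathcal{R}$ of rules; $G\Rightarrow_{\mathcal{R}}H$ iff $G\Rightarrow_r H$ for some $r\in\mathcal{R}$. Let $\mathcal{G}^{\oplus}(\mathcal{L})$ be the set of isomorphism classes of TLRGs; the induced relation is $[G]\to[H]$ iff $G\Rightarrow_{\mathcal{R}}H$. Rules $r_1,r_2$ are isomorphic ($r_1\cong r_2$) iff there are isomorphisms $f:L_1\to L_2$, $g:R_1\to R_2$ agreeing on $K_1$ with $f(K_1)=K_2$. The normal form of $r=\langle L\leftarrow K\rightarrow R\rangle$ is $r\!\downarrow=\langle L\leftarrow K'\rightarrow R\rangle$ where $K'$ has node set $V_K$, no edges, no labels and undefined rootedness; $r_1\simeq r_2$ iff $r_1\!\downarrow\cong r_2\!\downarrow$. Then: $T_1\cong T_2$ iff $\mathcal{R}_1$ and $\mathcal{R}_2$ have the same set of $\cong$-classes; $T_1\simeq_N T_2$ iff they have the same set of $\simeq$-classes; $T_1\simeq_S T_2$ iff their induced relations on $\mathcal{G}^{\oplus}(\mathcal{L})$ are identical; $T_1\simeq_F T_2$ iff their semantic functions coincide, where the semantic function $f_T$ on $\mathcal{G}^{\oplus}(\mathcal{L})\cup\{\bot\}$ is $f_T([G])=\{[H]\mid [G]\to^*[H],\ [H]\text{ has no }\to\text{-successor}\}\cup\{\bot\mid\text{there is an infinite }\to\text{-sequence starting at }[G]\}$ and $f_T(\bot)=\{\bot\}$. *)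

(* Defs.v *)
From Stdlib Require List.
From Stdlib Require Import Relations.
From mathcomp Require Import all_boot.

Set Implicit Arguments.
Unset Strict Implicit.
Unset Printing Implicit Defensive.

(* Sets of graphs, of rules and of isomorphism classes are plain predicates
   [T -> Prop]: the type of all graphs is too large to be the argument of
   [classical_sets.set] or to carry a [choiceType] structure.  Accordingly,
   two such sets are the same when they have the same elements. *)

(* [None] is an undefined node label, resp. an undefined rootedness. *)
Record graph (LV LE : finType) := Graph {
  node : finType;
  edge : finType;
  src : edge -> node;
  tgt : edge -> node;
  nlab : node -> option LV;
  elab : edge -> LE;
  rooted : node -> option bool
}.

Record tlrg (LV LE : finType) := TLRG {
  tlrg_graph :> graph LV LE;
  nlab_total : forall v : node tlrg_graph, isSome (nlab v);
  rooted_total : forall v : node tlrg_graph, isSome (rooted v)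
}.

Record hom (LV LE : finType) (G H : graph LV LE) := Hom {
  hnode : node G -> node H;
  hedge : edge G -> edge H;
  hom_src : forall e, hnode (src e) = src (hedge e);
  hom_tgt : forall e, hnode (tgt e) = tgt (hedge e);
  hom_elab : forall e, elab (hedge e) = elab e;
  hom_nlab : forall v a, nlab v = Some a -> nlab (hnode v) = Some a;
  hom_rooted : forall v b, rooted v = Some b -> rooted (hnode v) = Some b
}.

Section Graphs.
Variables LV LE : finType.
Implicit Types G H : graph LV LE.

Definition injective_hom G H (f : hom G H) : Prop :=
  injective (hnode f) /\ injective (hedge f).

Definition iso_hom G H (f : hom G H) : Prop :=
  exists g : hom H G,
    [/\ cancel (hnode f) (hnode g), cancel (hnode g) (hnode f),
        cancel (hedge f) (hedge g) & cancel (hedge g) (hedge f)].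

Definition graph_iso G H : Prop := exists f : hom G H, iso_hom f.

End Graphs.

(* The inclusion of a subgraph K of G (K_V, K_E subsets, structure and edge
   labels restricted, l_K contained in l_G, p_K contained in p_G) is given by
   an injective morphism from K to G: [hom_nlab] and [hom_rooted] say exactly
   that the partial functions of K are contained in those of G. *)
Record rule (LV LE : finType) := Rule {
  lhs : tlrg LV LE;
  itf : graph LV LE;
  rhs : tlrg LV LE;
  incL : hom itf lhs;
  incR : hom itf rhs;
  incL_inj : injective_hom incL;
  incR_inj : injective_hom incR
}.

Section Application.
Variables (LV LE : finType) (r : rule LV LE) (G : tlrg LV LE).
Variable (g : hom (lhs r) G).

Notation L := (lhs r).
Notation K := (itf r).
Notation R := (rhs r).
Notation iL := (incL r).
Notation iR := (incR r).

(* x is in g(V_L \ V_K) *)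
Definition del_node (x : node G) : bool :=
  [exists v : node L, (v \notin codom (hnode iL)) && (hnode g v == x)].

(* e is in g(E_L \ E_K) *)
Definition del_edge (e : edge G) : bool :=
  [exists a : edge L, (a \notin codom (hedge iL)) && (hedge g a == e)].

Definition dangling_condition : Prop :=
  forall e : edge G, e \notin codom (hedge g) ->
    ~~ del_node (src e) /\ ~~ del_node (tgt e).

Definition is_match : Prop := injective_hom g /\ dangling_condition.

Lemma keep_image (v : node K) :
  is_match -> ~~ del_node (hnode g (hnode iL v)).
Proof.
move=> [[ginj _] _]; apply/existsP => -[w /andP[wK /eqP /ginj E]].
by move: wK; rewrite E codom_f.
Qed.

Lemma keep_ends (e : edge G) :
  is_match -> ~~ del_edge e -> ~~ del_node (src e) /\ ~~ del_node (tgt e).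
Proof.
move=> m eK; have [/codomP[a ea]|eL] := boolP (e \in codom (hedge g)); last first.
  exact: (proj2 m).
have [/codomP[b ab]|aK] := boolP (a \in codom (hedge iL)); last first.
  by case/existsP: eK; exists a; rewrite aK ea eqxx.
by rewrite ea ab -!hom_src -!hom_tgt; split; exact: keep_image.
Qed.

Variable m : is_match.

(* The nodes and edges of G that survive the deletion, and those of R \ K. *)
Definition kept_node : finType := {x : node G | ~~ del_node x}.
Definition kept_edge : finType := {e : edge G | ~~ del_edge e}.
Definition new_node : finType := {w : node R | w \notin codom (hnode iR)}.
Definition new_edge : finType := {a : edge R | a \notin codom (hedge iR)}.

(* Some v when x = g(v) with v in V_K and l_K(v) undefined *)
Definition unlabelled_preim (x : node G) : option (node K) :=
  [pick v : node K | (hnode g (hnode iL v) == x) && ~~ isSome (nlab v)].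

(* Some v when x = g(v) with v in V_K and p_K(v) undefined *)
Definition unrooted_preim (x : node G) : option (node K) :=
  [pick v : node K | (hnode g (hnode iL v) == x) && ~~ isSome (rooted v)].

(* The intermediate graph: g(L \ K) is removed from G, and the images of the
   nodes of K without label (resp. rootedness) lose theirs. *)
Definition deletion : graph LV LE :=
  {| node := kept_node;
     edge := kept_edge;
     src := fun e : kept_edge =>
       exist _ (src (val e)) (proj1 (keep_ends m (valP e))) : kept_node;
     tgt := fun e : kept_edge =>
       exist _ (tgt (val e)) (proj2 (keep_ends m (valP e))) : kept_node;
     nlab := fun x : kept_node =>
       if unlabelled_preim (val x) is Some _ then None else nlab (val x);
     elab := fun e : kept_edge => elab (val e);
     rooted := fun x : kept_node =>
       if unrooted_preim (val x) is Some _ then None else rooted (val x) |}.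

(* Where a node of R is found in the result: at the image under g if it belongs
   to K ([iinv] gives the node of K it comes from), as a fresh node if not. *)
Definition comatch_node (w : node R) : kept_node + new_node :=
  match boolP (w \in codom (hnode iR)) with
  | AltTrue wK => inl (exist _ (hnode g (hnode iL (iinv wK)))
                               (keep_image (iinv wK) m))
  | AltFalse wNK => inr (exist _ w wNK)
  end.

Definition result : graph LV LE :=
  {| node := (node deletion + new_node)%type;
     edge := (edge deletion + new_edge)%type;
     src := fun e => match e with
       | inl d => inl (src d)
       | inr a => comatch_node (src (val a))
       end;
     tgt := fun e => match e with
       | inl d => inl (tgt d)
       | inr a => comatch_node (tgt (val a))
       end;
     nlab := fun x => match x with
       | inl d => if unlabelled_preim (val d) is Some v then nlab (hnode iR v)
                  else nlab d
       | inr w => nlab (val w)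
       end;
     elab := fun e => match e with
       | inl d => elab d
       | inr a => elab (val a)
       end;
     rooted := fun x => match x with
       | inl d => if unrooted_preim (val d) is Some v then rooted (hnode iR v)
                  else rooted d
       | inr w => rooted (val w)
       end |}.

End Application.

Definition rule_step (LV LE : finType) (r : rule LV LE) (G M : tlrg LV LE) :
    Prop :=
  exists (g : hom (lhs r) G) (m : is_match g), graph_iso M (result m).

Record gts (LV LE : finType) := GTS {
  gts_rules :> rule LV LE -> Prop;
  gts_finite : exists s : list (rule LV LE), forall r, gts_rules r <-> List.In r s
}.

(* f and g agree on K_1 and f(K_1) = K_2, as graphs: the common restriction of
   f and g is an isomorphism h from K_1 to K_2. *)
Definition rule_iso (LV LE : finType) (r1 r2 : rule LV LE) : Prop :=
  exists (f : hom (lhs r1) (lhs r2)) (g : hom (rhs r1) (rhs r2))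
         (h : hom (itf r1) (itf r2)),
    [/\ iso_hom f, iso_hom g & iso_hom h] /\
    [/\ forall v, hnode f (hnode (incL r1) v) = hnode (incL r2) (hnode h v),
        forall v, hnode g (hnode (incR r1) v) = hnode (incR r2) (hnode h v),
        forall e, hedge f (hedge (incL r1) e) = hedge (incL r2) (hedge h e) &
        forall e, hedge g (hedge (incR r1) e) = hedge (incR r2) (hedge h e)].

Section NormalForm.
Variables (LV LE : finType).

Definition bare_graph (K : graph LV LE) : graph LV LE :=
  {| node := node K;
     edge := void;
     src := of_void (node K);
     tgt := of_void (node K);
     nlab := fun _ => None;
     elab := of_void LE;
     rooted := fun _ => None |}.

Definition bare_hom (K G : graph LV LE) (f : hom K G) : hom (bare_graph K) G.
Proof.
by exists (hnode f : node (bare_graph K) -> node G)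
          (of_void (edge G) : edge (bare_graph K) -> edge G) => //; case.
Defined.

Lemma bare_hom_inj (K G : graph LV LE) (f : hom K G) :
  injective_hom f -> injective_hom (bare_hom f).
Proof. by case=> fV _; split=> //; case. Qed.

Definition normal_form (r : rule LV LE) : rule LV LE :=
  {| lhs := lhs r;
     itf := bare_graph (itf r);
     rhs := rhs r;
     incL := bare_hom (incL r);
     incR := bare_hom (incR r);
     incL_inj := bare_hom_inj (incL_inj r);
     incR_inj := bare_hom_inj (incR_inj r) |}.

Definition rule_nequiv (r1 r2 : rule LV LE) : Prop :=
  rule_iso (normal_form r1) (normal_form r2).

End NormalForm.

(* The class of x under E is the predicate [E x]. *)
Definition same_classes (T : Type) (E : T -> T -> Prop) (A B : T -> Prop) : Prop :=
  forall C : T -> Prop,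
    (exists2 x, A x & C = E x) <-> (exists2 x, B x & C = E x).

Section Systems.
Variables LV LE : finType.

Definition gclass : Type :=
  {C : tlrg LV LE -> Prop | exists G : tlrg LV LE, C = fun H => graph_iso G H}.

Definition iso_class (G : tlrg LV LE) : gclass :=
  exist _ (fun H : tlrg LV LE => graph_iso G H) (ex_intro _ G erefl).

Definition gts_step (T : gts LV LE) (G H : tlrg LV LE) : Prop :=
  exists2 r, T r & rule_step r G H.

Definition class_step (T : gts LV LE) (C D : gclass) : Prop :=
  exists G H, [/\ C = iso_class G, D = iso_class H & gts_step T G H].

(* [None] is bottom; [sem T x] is f_T(x), as a predicate. *)
Definition sem (T : gts LV LE) (x y : option gclass) : Prop :=
  match x, y with
  | Some C, Some D =>
      clos_refl_trans gclass (class_step T) C D /\ ~ exists D', class_step T D D'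
  | Some C, None =>
      exists s : nat -> gclass, s 0 = C /\ forall n, class_step T (s n) (s n.+1)
  | None, None => True
  | None, Some _ => False
  end.

Definition gts_iso (T1 T2 : gts LV LE) : Prop :=
  same_classes (@rule_iso LV LE) T1 T2.

Definition gts_equivN (T1 T2 : gts LV LE) : Prop :=
  same_classes (@rule_nequiv LV LE) T1 T2.

Definition gts_equivS (T1 T2 : gts LV LE) : Prop :=
  forall C D : gclass, class_step T1 C D <-> class_step T2 C D.

Definition gts_equivF (T1 T2 : gts LV LE) : Prop :=
  forall x y : option gclass, sem T1 x y <-> sem T2 x y.

End Systems.

(* Main.v *)
Require Import Defs.
From mathcomp Require Import all_boot.
From Stdlib Require Import FunctionalExtensionality PropExtensionality
  ProofIrrelevance IndefiniteDescription.

(** The label and the rootedness which a node of the result gets from an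
    interface node [k] are those of [k] in [R], whether or not they are defined
    in [K]; likewise an edge of [K] may equally well be kept or be deleted and
    created again. Hence a rule and its normal form have the same steps, and the
    steps of a rule only depend on its isomorphism class.

    Strictness, for a one-letter alphabet:
    - the identity rule of a labelled node is not isomorphic to its normal form;
    - adding the identity rule of a node to that of the empty graph adds no step;
    - the identity rule of the empty graph and the rule creating a node are both
      always applicable, so both systems never terminate and have the same
      semantic function, but only the former has a step from the empty graph to
      itself. *)

Set Implicit Arguments.
Unset Strict Implicit.
Unset Printing Implicit Defensive.

(** Classes are predicates, so their equality rests on functional and propositional
    extensionality. *)
Lemma predeq (T : Type) (A B : T -> Prop) : (forall x, A x <-> B x) -> A = B.
Proof.
by move=> AB; apply: functional_extensionality => x; exact: propositional_extensionality.
Qed.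

(** * Isomorphisms of graphs and of rules *)

Section Isomorphisms.
Variables LV LE : finType.
Implicit Types G H J : graph LV LE.

Definition hom_id G : hom G G :=
  @Hom LV LE G G id id (fun=> erefl) (fun=> erefl) (fun=> erefl)
    (fun _ _ E => E) (fun _ _ E => E).

Definition hom_comp G H J (g : hom H J) (f : hom G H) : hom G J.
Proof.
exists (hnode g \o hnode f) (hedge g \o hedge f) => /=.
- by move=> e; rewrite !hom_src.
- by move=> e; rewrite !hom_tgt.
- by move=> e; rewrite !hom_elab.
- by move=> v a /(hom_nlab f) /(hom_nlab g).
- by move=> v b /(hom_rooted f) /(hom_rooted g).
Defined.

Lemma iso_hom_id G : iso_hom (hom_id G).
Proof. by exists (hom_id G); split. Qed.

Lemma iso_hom_comp G H J (g : hom H J) (f : hom G H) :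
  iso_hom g -> iso_hom f -> iso_hom (hom_comp g f).
Proof.
move=> [g' [g1 g2 g3 g4]] [f' [f1 f2 f3 f4]].
by exists (hom_comp f' g'); split; apply: can_comp.
Qed.

Lemma graph_iso_refl G : graph_iso G G.
Proof. by exists (hom_id G); apply: iso_hom_id. Qed.

Lemma graph_iso_sym G H : graph_iso G H -> graph_iso H G.
Proof. by move=> [f [g [? ? ? ?]]]; exists g, f; split. Qed.

Lemma graph_iso_trans G H J : graph_iso G H -> graph_iso H J -> graph_iso G J.
Proof.
by move=> [f If] [g Ig]; exists (hom_comp g f); apply: iso_hom_comp.
Qed.

Lemma iso_hom_inj G H (f : hom G H) : iso_hom f -> injective_hom f.
Proof. by move=> [g [/can_inj ? _ /can_inj ? _]]; split. Qed.

(** A total labelling leaves no undefined case in which the morphism could add a label. *)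
Lemma hom_nlab_total (G : tlrg LV LE) H (f : hom G H) v :
  nlab (hnode f v) = nlab v.
Proof.
by case E: (nlab v) (nlab_total v) => [a|//] _; apply: hom_nlab.
Qed.

Lemma hom_rooted_total (G : tlrg LV LE) H (f : hom G H) v :
  rooted (hnode f v) = rooted v.
Proof.
by case E: (rooted v) (rooted_total v) => [a|//] _; apply: hom_rooted.
Qed.

(** Bijections are given as relations because nodes and edges of a result are sums of sigma types: a
    relation can compare the underlying values without building membership proofs. *)
Definition bij_rel (X Y : Type) (rho : X -> Y -> Prop) : Prop :=
  [/\ forall x, exists y, rho x y, forall y, exists x, rho x y,
      forall x y y', rho x y -> rho x y' -> y = y' &
      forall x x' y, rho x y -> rho x' y -> x = x'].

(** Choice turns the two totality clauses into functions; the two uniqueness clauses make them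
    mutually inverse. *)
Lemma bij_rel_fun (X Y : Type) (rho : X -> Y -> Prop) : bij_rel rho ->
  exists (f : X -> Y) (g : Y -> X),
    [/\ cancel f g, cancel g f, forall x, rho x (f x) & forall y, rho (g y) y].
Proof.
move=> [/functional_choice[f fP] /functional_choice[g gP] rho_fun rho_inj].
exists f, g; split=> // x.
  exact: rho_inj (gP (f x)) (fP x).
exact: rho_fun (fP (g x)) (gP x).
Qed.

(** Main tool for comparing results. Labels and rootedness agree as options, undefined values
    included, so the maps in both directions are morphisms. *)
Lemma graph_iso_rel G H (rN : node G -> node H -> Prop)
    (rE : edge G -> edge H -> Prop) :
  bij_rel rN -> bij_rel rE ->
  (forall e e', rE e e' ->
     [/\ rN (src e) (src e'), rN (tgt e) (tgt e') & elab e = elab e']) ->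
  (forall x x', rN x x' -> nlab x = nlab x' /\ rooted x = rooted x') ->
  graph_iso G H.
Proof.
move=> bN bE eP nP.
have [f [f' [fK f'K fP f'P]]] := bij_rel_fun bN.
have [h [h' [hK h'K hP h'P]]] := bij_rel_fun bE.
have [_ _ rN_fun rN_inj] := bN.
have F : exists F : hom G H, hnode F = f /\ hedge F = h.
  unshelve eexists; first exists f h; last by [].
  - move=> e; have [s _ _] := eP _ _ (hP e); exact: rN_fun (fP _) s.
  - move=> e; have [_ s _] := eP _ _ (hP e); exact: rN_fun (fP _) s.
  - by move=> e; have [_ _ ->] := eP _ _ (hP e).
  - by move=> v a <-; have [-> _] := nP _ _ (fP v).
  - by move=> v a <-; have [_ ->] := nP _ _ (fP v).
have F' : exists F : hom H G, hnode F = f' /\ hedge F = h'.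
  unshelve eexists; first exists f' h'; last by [].
  - move=> e; have [s _ _] := eP _ _ (h'P e); exact: rN_inj (f'P _) s.
  - move=> e; have [_ s _] := eP _ _ (h'P e); exact: rN_inj (f'P _) s.
  - by move=> e; have [_ _ ->] := eP _ _ (h'P e).
  - by move=> v a <-; have [<- _] := nP _ _ (f'P v).
  - by move=> v a <-; have [_ <-] := nP _ _ (f'P v).
move: F F' => [F [FN FE]] [F' [FN' FE']].
by exists F, F'; rewrite FN FE FN' FE'; split.
Qed.

Lemma rule_iso_refl (r : rule LV LE) : rule_iso r r.
Proof.
by exists (hom_id _), (hom_id _), (hom_id _); split; split=> //; apply: iso_hom_id.
Qed.

Lemma rule_iso_sym (r1 r2 : rule LV LE) : rule_iso r1 r2 -> rule_iso r2 r1.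
Proof.
move=> [f [g [h [[]]]]].
move=> [f' [f1 f2 f3 f4]] [g' [g1 g2 g3 g4]] [h' [h1 h2 h3 h4]] [fV gV fE gE].
exists f', g', h'; split; split; [by exists f|by exists g|by exists h|..] => x.
- by rewrite -{1}[x]h2 -fV f1.
- by rewrite -{1}[x]h2 -gV g1.
- by rewrite -{1}[x]h4 -fE f3.
- by rewrite -{1}[x]h4 -gE g3.
Qed.

Lemma rule_iso_trans (r1 r2 r3 : rule LV LE) :
  rule_iso r1 r2 -> rule_iso r2 r3 -> rule_iso r1 r3.
Proof.
move=> [f [g [h [[If Ig Ih] [fV gV fE gE]]]]].
move=> [f' [g' [h' [[If' Ig' Ih'] [fV' gV' fE' gE']]]]].
exists (hom_comp f' f), (hom_comp g' g), (hom_comp h' h).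
split; split; try exact: iso_hom_comp; move=> x /=.
- by rewrite fV fV'.
- by rewrite gV gV'.
- by rewrite fE fE'.
- by rewrite gE gE'.
Qed.

(** Without edges, labels or rootedness, every node map between bare graphs is a morphism; the node
    parts of [h] and of its inverse therefore suffice. *)
Lemma bare_graph_iso G H (h : hom G H) : iso_hom h ->
  exists2 k : hom (bare_graph G) (bare_graph H), iso_hom k & hnode k = hnode h.
Proof.
have bare (J J' : graph LV LE) (f : node J -> node J') :
    exists k : hom (bare_graph J) (bare_graph J'), hnode k = f.
  by unshelve eexists (@Hom _ _ (bare_graph J) (bare_graph J') f id _ _ _ _ _) => //; case.
move=> [h' [h1 h2 _ _]].
have [k kh] := bare _ _ (hnode h); have [k' kh'] := bare _ _ (hnode h').
by exists k => //; exists k'; rewrite kh kh'; split=> //; case.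
Qed.

(** The node conditions are inherited and the edge conditions are vacuous over [void]. *)
Lemma rule_iso_nequiv (r1 r2 : rule LV LE) : rule_iso r1 r2 -> rule_nequiv r1 r2.
Proof.
move=> [f [g [h [[If Ig Ih] [fV gV _ _]]]]].
have [k Ik kh] := bare_graph_iso Ih.
by exists f, g, k; rewrite kh; split; split=> //; case.
Qed.

End Isomorphisms.

(** * Nodes, edges and labels of the result of a rule application *)

Section Results.
Variables (LV LE : finType) (r : rule LV LE) (G : tlrg LV LE).
Variables (g : hom (lhs r) G) (m : is_match g).

Definition keep_node x (xP : ~~ del_node g x) : kept_node g := exist _ x xP.
Definition keep_edge e (eP : ~~ del_edge g e) : kept_edge g := exist _ e eP.
Definition add_node w (wP : w \notin codom (hnode (incR r))) : new_node r :=
  exist _ w wP.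
Definition add_edge a (aP : a \notin codom (hedge (incR r))) : new_edge r :=
  exist _ a aP.

Lemma del_nodeP x : reflect
  (exists2 v, v \notin codom (hnode (incL r)) & hnode g v = x) (del_node g x).
Proof.
by apply: (iffP existsP) => [[v /andP[vK /eqP]]|[v vK /eqP E]];
  exists v => //; rewrite vK.
Qed.

Lemma del_edgeP e : reflect
  (exists2 a, a \notin codom (hedge (incL r)) & hedge g a = e) (del_edge g e).
Proof.
by apply: (iffP existsP) => [[v /andP[vK /eqP]]|[v vK /eqP E]];
  exists v => //; rewrite vK.
Qed.

(** A surviving node in the image of [g] cannot come from L \ K, which was deleted, so it comes from
    K. *)
Lemma kept_nodeP (d : kept_node g) :
  (exists k, val d = hnode g (hnode (incL r) k)) \/ val d \notin codom (hnode g).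
Proof.
have [/codomP[v dv]|] := boolP (val d \in codom (hnode g)); last by right.
have [/codomP[k vk]|vK] := boolP (v \in codom (hnode (incL r))).
  by left; exists k; rewrite dv vk.
by case/del_nodeP: (valP d); exists v.
Qed.

Lemma kept_edgeP (d : kept_edge g) :
  (exists k, val d = hedge g (hedge (incL r) k)) \/ val d \notin codom (hedge g).
Proof.
have [/codomP[v dv]|] := boolP (val d \in codom (hedge g)); last by right.
have [/codomP[k vk]|vK] := boolP (v \in codom (hedge (incL r))).
  by left; exists k; rewrite dv vk.
by case/del_edgeP: (valP d); exists v.
Qed.

Lemma match_incL_inj : injective (fun k => hnode g (hnode (incL r) k)).
Proof.
have [[gI _] _] := m; have [iI _] := incL_inj r.
by move=> k k' /gI /iI.
Qed.

(** Separates the nodes of K from the fresh ones while hiding the membership proof on which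
    [comatch_node] matches. *)
Lemma comatch_nodeP w :
  (exists k d, [/\ w = hnode (incR r) k, comatch_node m w = inl d &
                   val d = hnode g (hnode (incL r) k)]) \/
  (exists2 d, comatch_node m w = inr d & val d = w).
Proof.
rewrite /comatch_node; case: {-}_ / boolP => [wK|wK]; [left|right].
  by exists (iinv wK), (keep_node (keep_image (iinv wK) m)); rewrite f_iinv.
by exists (add_node wK).
Qed.

Lemma comatch_node_incR k : exists2 d, comatch_node m (hnode (incR r) k) = inl d &
  val d = hnode g (hnode (incL r) k).
Proof.
have [iI _] := incR_inj r.
case: (comatch_nodeP (hnode (incR r) k)) => [[k' [d [/iI -> E1 E2]]]|[d _ E]].
  by exists d.
by have := valP d; rewrite /= E codom_f.
Qed.

(** If [k] is unlabelled in K, its label is taken from R by construction. If it is labelled in K,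
    both inclusions and [g] preserve that label, so the one retained from G is again that of R. *)
Lemma result_nlab_itf (d : kept_node g) k :
  val d = hnode g (hnode (incL r) k) ->
  @nlab _ _ (result m) (inl d) = nlab (hnode (incR r) k).
Proof.
move=> dk /=; rewrite /unlabelled_preim; case: pickP => [k' /andP[/eqP]|/(_ k)].
  by rewrite dk => /match_incL_inj ->.
rewrite dk eqxx /=; case E: (nlab k) => [a|//] _.
by rewrite (hom_nlab _ E) !hom_nlab_total; apply: hom_nlab.
Qed.

Lemma result_rooted_itf (d : kept_node g) k :
  val d = hnode g (hnode (incL r) k) ->
  @rooted _ _ (result m) (inl d) = rooted (hnode (incR r) k).
Proof.
move=> dk /=; rewrite /unrooted_preim; case: pickP => [k' /andP[/eqP]|/(_ k)].
  by rewrite dk => /match_incL_inj ->.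
rewrite dk eqxx /=; case E: (rooted k) => [a|//] _.
by rewrite (hom_rooted _ E) !hom_rooted_total; apply: hom_rooted.
Qed.

Lemma result_nlab_context (d : kept_node g) : val d \notin codom (hnode g) ->
  @nlab _ _ (result m) (inl d) = nlab (val d).
Proof.
move=> dL /=; rewrite /unlabelled_preim; case: pickP => // k /andP[/eqP E _].
by case/negP: dL; apply/codomP; exists (hnode (incL r) k); rewrite E.
Qed.

Lemma result_rooted_context (d : kept_node g) : val d \notin codom (hnode g) ->
  @rooted _ _ (result m) (inl d) = rooted (val d).
Proof.
move=> dL /=; rewrite /unrooted_preim; case: pickP => // k /andP[/eqP E _].
by case/negP: dL; apply/codomP; exists (hnode (incL r) k); rewrite E.
Qed.

(** With its analogue for rootedness, this makes the result a TLRG, which a step requires of its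
    target. *)
Lemma result_nlab_total (x : node (result m)) : isSome (nlab x).
Proof.
case: x => [d|w]; last exact: nlab_total.
case: (kept_nodeP d) => [[k /result_nlab_itf ->]|/result_nlab_context ->];
  exact: nlab_total.
Qed.

Lemma result_rooted_total (x : node (result m)) : isSome (rooted x).
Proof.
case: x => [d|w]; last exact: rooted_total.
case: (kept_nodeP d) => [[k /result_rooted_itf ->]|/result_rooted_context ->];
  exact: rooted_total.
Qed.

Definition result_tlrg : tlrg LV LE := TLRG result_nlab_total result_rooted_total.

Lemma rule_step_result : rule_step r G result_tlrg.
Proof. by exists g, m; apply: graph_iso_refl. Qed.

End Results.

(** * Steps are invariant under normal forms and rule isomorphisms *)

Section Invariance.
Variables (LV LE : finType).
Implicit Types (r : rule LV LE) (G M : tlrg LV LE).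

(* [del_node], hence [is_match] and the node type of the result, only involve
   the nodes of the interface: for [r] and its normal form they are
   convertible. An edge of the interface is kept by [r], and deleted then
   created again by the normal form. *)
Lemma result_normal_form r G (g : hom (lhs r) G) (m : is_match g) :
  graph_iso (result m) (@result _ _ (normal_form r) G g m).
Proof.
set r' := normal_form r; set m' : @is_match _ _ r' G g := m.
have [[gNI gEI] _] := m; have [_ iLI] := incL_inj r; have [_ iRI] := incR_inj r.
(* The mixed case [inl d, inr a'] is an interface edge [k], kept by [r] but recreated by the normal
   form. The opposite case cannot occur. *)
pose rE (e : edge (result m)) (e' : edge (result m')) : Prop :=
  match e, e' with
  | inl d, inl d' => val d = val d'
  | inr a, inr a' => val a = val a'
  | inl d, inr a' => exists2 k,
      val d = hedge g (hedge (incL r) k) & val a' = hedge (incR r) k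
  | inr _, inl _ => False
  end.
(* With no edges in its interface, the normal form deletes every edge of g(L) and creates every edge
   of R. *)
have del' e : @del_edge _ _ r' G g e = (e \in codom (hedge g)).
  apply/idP/idP => [/del_edgeP[a _ <-]|/codomP[a ->]]; first exact: codom_f.
  by apply/del_edgeP; exists a => //; apply/codomP => -[[]].
have new' a : a \notin codom (hedge (incR r')) by apply/codomP => -[[]].
have keptK k : ~~ del_edge g (hedge g (hedge (incL r) k)).
  by apply/del_edgeP => -[a aK /gEI E]; move: aK; rewrite E codom_f.
(* The facts [old] and [new] keep the three cases of [rE] disjoint: an interface edge is neither
   kept by the normal form nor created by [r]. *)
have old (d : kept_edge g) (d' : @kept_edge _ _ r' G g) k :
    val d = val d' -> val d = hedge g (hedge (incL r) k) -> False.
  by move=> E E'; have := valP d'; rewrite del' -E E' codom_f.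
have new (a : new_edge r) k : val a = hedge (incR r) k -> False.
  by move=> E; have := valP a; rewrite E codom_f.
(* Equality typechecks here because the node types of the two results are convertible. *)
pose rN (x : node (result m)) (y : node (result m')) : Prop := x = y.
have rN_comatch w : rN (comatch_node m w) (comatch_node m' w).
  case: (comatch_nodeP m w) => [[k [d [-> -> dk]]]|[d -> dw]].
    have [d' E d'k] := comatch_node_incR m' k.
    by rewrite /rN [RHS]E; congr inl; apply: val_inj; rewrite /= dk; apply: esym.
  case: (comatch_nodeP m' w) => [[k [d' [E _ _]]]|[d' E d'w]].
    by case/negP: (valP d); apply/codomP; exists k; apply: etrans dw E.
  by rewrite /rN [RHS]E; congr inr; apply: val_inj; rewrite /= dw; apply: esym.
apply: (@graph_iso_rel _ _ (result m) (result m') rN rE).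
- by split=> [x|y|x y y' <-|x x' y ->]; [exists x|exists y|..].
- split.
  + case=> [d|a]; last by exists (inr (@add_edge _ _ r' _ (new' (val a)))).
    case: (kept_edgeP d) => [[k dk]|dL].
      by exists (inr (@add_edge _ _ r' _ (new' (hedge (incR r) k)))), k.
    have d' : ~~ @del_edge _ _ r' G g (val d) by rewrite del'.
    by exists (inl (@keep_edge _ _ r' G g _ d')).
  + case=> [d|a].
      have d' : ~~ del_edge g (val d).
        have := valP d; rewrite del'.
        by apply: contra => /del_edgeP[a _ <-]; apply: codom_f.
      by exists (inl (keep_edge d')).
    have [/codomP[k ak]|aK] := boolP (val a \in codom (hedge (incR r))).
      by exists (inl (keep_edge (keptK k))), k.
    by exists (inr (add_edge aK)).
  + case=> [d|a] [d'|a'] [e|b] //=.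
    * by move=> E1 E2; congr inl; apply: val_inj; rewrite /= -E1.
    * by move=> E [k /(old _ _ _ E)].
    * by move=> [k E _] /old /(_ E).
    * move=> [k E1 E2] [k' E1' E2']; congr inr; apply: val_inj.
      move: E1; rewrite E1' => /gEI /iLI E.
      by rewrite /= E2 E2' E.
    * by move=> E1 E2; congr inr; apply: val_inj; rewrite /= -E1.
  + case=> [d|a] [d'|a'] [e|b] //=.
    * by move=> E1 E2; congr inl; apply: val_inj; rewrite /= E1.
    * move=> [k E1 E2] [k' E1' E2']; congr inl; apply: val_inj.
      move: E2; rewrite E2' => /iRI E.
      by rewrite /= E1 E1' E.
    * by move=> [k _ E] E'; case: (new a' k (etrans E' E)).
    * by move=> E' [k _ E]; case: (new a k (etrans E' E)).
    * by move=> E1 E2; congr inr; apply: val_inj; rewrite /= E1.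
- case=> [d|a] [d'|a'] //=.
  + by move=> E; split=> //; [congr inl|congr inl|]; rewrite ?E //;
      apply: val_inj; rewrite /= E.
  (* The ends of an interface edge are interface nodes, so the comatch sends the ends of the
     recreated edge to the kept nodes at which [d] is attached. *)
  + move=> [k E E']; split.
    * rewrite E' -hom_src.
      have [d1 Ed1 Ed2] := comatch_node_incR m' (src k).
      rewrite [comatch_node _ _]Ed1; congr inl; apply: val_inj.
      by rewrite Ed2 /= E -!hom_src.
    * rewrite E' -hom_tgt.
      have [d1 Ed1 Ed2] := comatch_node_incR m' (tgt k).
      rewrite [comatch_node _ _]Ed1; congr inl; apply: val_inj.
      by rewrite Ed2 /= E -!hom_tgt.
    * by rewrite E E' !hom_elab.
  + by move=> E; split; rewrite ?E //; apply: rN_comatch.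
(* The two interfaces differ in labels, but the resulting label depends only on R at interface nodes
   and only on G elsewhere. *)
- move=> x _ <-; case: x => [d|w] //.
  case: (kept_nodeP d) => [[k dk]|dL].
    by rewrite (result_nlab_itf m dk) (result_nlab_itf m' dk)
      (result_rooted_itf m dk) (result_rooted_itf m' dk).
  by rewrite (result_nlab_context m dL) (result_nlab_context m' dL)
    (result_rooted_context m dL) (result_rooted_context m' dL).
Qed.

Lemma rule_step_normal_form r G M :
  rule_step (normal_form r) G M <-> rule_step r G M.
Proof.
split=> -[g [m GM]]; exists g, m; apply: graph_iso_trans GM _.
  exact/graph_iso_sym/(@result_normal_form r G g m).
exact: result_normal_form.
Qed.

(** The match is transported along the inverse of the isomorphism of left-hand sides. Both
    applications then keep the same part of G, and the isomorphism of right-hand sides identifies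
    the created parts. *)
Lemma rule_step_iso r1 r2 G M :
  rule_iso r1 r2 -> rule_step r1 G M -> rule_step r2 G M.
Proof.
move=> [f [j [h [[If Ij Ih] [fV jV fE jE]]]]] [g1 [m1 GM]].
have [jVI jEI] := iso_hom_inj Ij.
move: If Ih Ij => [f' [fNK fNK' fEK fEK']] [h' [hNK hNK' hEK hEK']].
move=> [j' [jNK jNK' jEK jEK']].
pose g2 := hom_comp g1 f'.
have g2V v : hnode g2 (hnode f v) = hnode g1 v by rewrite /= fNK.
have g2E e : hedge g2 (hedge f e) = hedge g1 e by rewrite /= fEK.
(* Since [f] is bijective and takes K1 onto K2, it takes L1 \ K1 onto L2 \ K2. *)
have delV x : del_node g2 x = del_node g1 x.
  apply/del_nodeP/del_nodeP => -[v vK <-].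
    exists (hnode f' v) => //; apply: contra vK => /codomP[k E].
    by apply/codomP; exists (hnode h k); rewrite -fV -E fNK'.
  exists (hnode f v) => //; apply: contra vK => /codomP[k E].
  by apply/codomP; exists (hnode h' k); rewrite -[v]fNK E -[k in LHS]hNK' -fV fNK.
have delE e : del_edge g2 e = del_edge g1 e.
  apply/del_edgeP/del_edgeP => -[v vK <-].
    exists (hedge f' v) => //; apply: contra vK => /codomP[k E].
    by apply/codomP; exists (hedge h k); rewrite -fE -E fEK'.
  exists (hedge f v) => //; apply: contra vK => /codomP[k E].
  by apply/codomP; exists (hedge h' k); rewrite -[v]fEK E -[k in LHS]hEK' -fE fEK.
have newV w : (hnode j w \in codom (hnode (incR r2))) = (w \in codom (hnode (incR r1))).
  apply/codomP/codomP => -[k E]; last by exists (hnode h k); rewrite E jV.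
  by exists (hnode h' k); apply: jVI; rewrite jV hNK'.
have newE a : (hedge j a \in codom (hedge (incR r2))) = (a \in codom (hedge (incR r1))).
  apply/codomP/codomP => -[k E]; last by exists (hedge h k); rewrite E jE.
  by exists (hedge h' k); apply: jEI; rewrite jE hEK'.
(* Both matches have the same image and delete the same nodes, so the dangling condition carries
   over. *)
have m2 : is_match g2.
  have [[g1VI g1EI] dang] := m1; split.
    by split; apply: inj_comp => //; [exact: can_inj fNK'|exact: can_inj fEK'].
  move=> e eL; rewrite !delV; apply: dang; apply: contra eL => /codomP[a ->].
  by rewrite -g2E codom_f.
exists g2, m2; apply: graph_iso_trans GM _.
pose rN (x : node (result m1)) (y : node (result m2)) : Prop :=
  match x, y with
  | inl d, inl d' => val d = val d'
  | inr w, inr w' => hnode j (val w) = val w'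
  | _, _ => False
  end.
pose rE (x : edge (result m1)) (y : edge (result m2)) : Prop :=
  match x, y with
  | inl d, inl d' => val d = val d'
  | inr w, inr w' => hedge j (val w) = val w'
  | _, _ => False
  end.
have rN_comatch w : rN (comatch_node m1 w) (comatch_node m2 (hnode j w)).
  case: (comatch_nodeP m1 w) => [[k [d [-> -> dk]]]|[d -> dw]].
    rewrite jV; have [d' -> d'k] := comatch_node_incR m2 (hnode h k).
    by rewrite /rN d'k -fV g2V.
  case: (comatch_nodeP m2 (hnode j w)) => [[k [d' [E _ _]]]|[d' -> d'w]].
    by have := valP d; rewrite /= dw -newV E codom_f.
  by rewrite /rN dw d'w.
apply: (@graph_iso_rel _ _ _ _ rN rE).
- split.
  + case=> [[x xP]|[w wP]].
      have xP' : ~~ del_node g2 x by rewrite delV.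
      by exists (inl (keep_node xP')).
    have wP' : hnode j w \notin codom (hnode (incR r2)) by rewrite newV.
    by exists (inr (add_node wP')).
  + case=> [[x xP]|[w wP]].
      have xP' : ~~ del_node g1 x by rewrite -delV.
      by exists (inl (keep_node xP')).
    have wP' : hnode j' w \notin codom (hnode (incR r1)) by rewrite -newV jNK'.
    by exists (inr (add_node wP')); rewrite /= jNK'.
  + case=> [x|w] [y|v] [y'|v'] //= E1 E2; [congr inl|congr inr]; apply: val_inj;
      by rewrite /= -E1.
  + case=> [x|w] [y|v] [y'|v'] //= E1 E2; [congr inl|congr inr]; apply: val_inj.
      by rewrite /= E1.
    by apply: jVI; rewrite /= E1.
- split.
  + case=> [[x xP]|[w wP]].
      have xP' : ~~ del_edge g2 x by rewrite delE.
      by exists (inl (keep_edge xP')).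
    have wP' : hedge j w \notin codom (hedge (incR r2)) by rewrite newE.
    by exists (inr (add_edge wP')).
  + case=> [[x xP]|[w wP]].
      have xP' : ~~ del_edge g1 x by rewrite -delE.
      by exists (inl (keep_edge xP')).
    have wP' : hedge j' w \notin codom (hedge (incR r1)) by rewrite -newE jEK'.
    by exists (inr (add_edge wP')); rewrite /= jEK'.
  + case=> [x|w] [y|v] [y'|v'] //= E1 E2; [congr inl|congr inr]; apply: val_inj;
      by rewrite /= -E1.
  + case=> [x|w] [y|v] [y'|v'] //= E1 E2; [congr inl|congr inr]; apply: val_inj.
      by rewrite /= E1.
    by apply: jEI; rewrite /= E1.
- case=> [d|a] [d'|a'] //= E.
    by rewrite E.
  by rewrite -E -hom_src -hom_tgt hom_elab; split.
- case=> [d|w] [d'|w'] //; last first.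
    by move=> /= <-; rewrite hom_nlab_total hom_rooted_total.
  move=> E; have {}E : val d = val d' := E; case: (kept_nodeP d) => [[k dk]|dL].
    have d'k : val d' = hnode g2 (hnode (incL r2) (hnode h k)).
      by rewrite -fV g2V -dk.
    rewrite (result_nlab_itf m1 dk) (result_nlab_itf m2 d'k).
    rewrite (result_rooted_itf m1 dk) (result_rooted_itf m2 d'k).
    by rewrite -jV hom_nlab_total hom_rooted_total.
  have d'L : val d' \notin codom (hnode g2).
    by apply: contra dL => /codomP[v vE]; apply/codomP; exists (hnode f' v); apply: etrans E vE.
  rewrite (result_nlab_context m1 dL) (result_nlab_context m2 d'L).
  by rewrite (result_rooted_context m1 dL) (result_rooted_context m2 d'L) E.
Qed.

Lemma rule_step_nequiv r1 r2 G M :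
  rule_nequiv r1 r2 -> rule_step r1 G M -> rule_step r2 G M.
Proof.
by move=> r12 /rule_step_normal_form /(rule_step_iso r12) /rule_step_normal_form.
Qed.

End Invariance.

(** * The three implications *)

Section Implications.
Variables LV LE : finType.
Implicit Types T : gts LV LE.

Lemma rule_iso_classP (r1 r2 : rule LV LE) :
  rule_iso r1 = rule_iso r2 <-> rule_iso r1 r2.
Proof.
split=> [->|r12]; first exact: rule_iso_refl.
apply: predeq => r; split; apply: rule_iso_trans => //.
exact: rule_iso_sym.
Qed.

Lemma rule_nequiv_classP (r1 r2 : rule LV LE) :
  rule_nequiv r1 = rule_nequiv r2 <-> rule_nequiv r1 r2.
Proof.
split=> [->|/rule_iso_classP E]; first exact: rule_iso_refl.
by apply: predeq => r; rewrite /rule_nequiv E.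
Qed.

(** Replaces equality of sets of classes by mutual inclusion of representatives up to [E]. *)
Lemma same_classesP (X : Type) (E : X -> X -> Prop) (A B : X -> Prop) :
  (forall x y, E x = E y <-> E x y) ->
  same_classes E A B <->
  (forall x, A x -> exists2 y, B y & E x y) /\
  (forall y, B y -> exists2 x, A x & E y x).
Proof.
move=> EP; split=> [AB|[AB BA] C].
  split=> x xA.
    have /AB[y yB /EP] : exists2 z, A z & E x = E z by exists x.
    by exists y.
  have /AB[y yB /EP] : exists2 z, B z & E x = E z by exists x.
  by exists y.
split=> -[x xA ->].
  by have [y yB /EP] := AB x xA; exists y.
by have [y yB /EP] := BA x xA; exists y.
Qed.

Lemma gts_iso_equivN T1 T2 : gts_iso T1 T2 -> gts_equivN T1 T2.
Proof.
move=> /(same_classesP _ _ rule_iso_classP)[T12 T21].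
apply/(same_classesP _ _ rule_nequiv_classP).
by split=> r; [move/T12|move/T21] => -[r' ? /rule_iso_nequiv ?]; exists r'.
Qed.

Lemma gts_equivN_equivS T1 T2 : gts_equivN T1 T2 -> gts_equivS T1 T2.
Proof.
move=> /(same_classesP _ _ rule_nequiv_classP)[T12 T21] C D.
split=> -[G [H [CG DH [r]]]]; [move/T12|move/T21] => -[r' r'T rr' s];
  by exists G, H; split=> //; exists r' => //; apply: rule_step_nequiv rr' s.
Qed.

Lemma gts_equivS_equivF T1 T2 : gts_equivS T1 T2 -> gts_equivF T1 T2.
Proof.
move=> T12; have E : class_step T1 = class_step T2.
  by apply: functional_extensionality => C; apply: predeq => D; apply: T12.
by move=> [C|] [D|] //=; rewrite E.
Qed.

End Implications.

(** * Tools for the examples: isomorphism classes, nontermination, identity and creation rules *)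

Section Examples.
Variables LV LE : finType.
Implicit Types (r : rule LV LE) (G H M : tlrg LV LE).

(** Evaluating both classes at [H] gives one direction; the other needs proof irrelevance for the
    second component of [gclass]. *)
Lemma iso_classP G H : iso_class G = iso_class H <-> graph_iso G H.
Proof.
split=> [|GH]; first by move/(congr1 (fun C => sval C H)) => /= ->; apply: graph_iso_refl.
apply: eq_sig_hprop => [*|/=]; first exact: proof_irrelevance.
apply: predeq => M; split; apply: graph_iso_trans => //.
exact: graph_iso_sym.
Qed.

Lemma gclassP (C : gclass LV LE) : exists G, C = iso_class G.
Proof.
case: C => C [G CG]; exists G; apply: eq_sig_hprop => //= *.
exact: proof_irrelevance.
Qed.

Definition gts_of (s : list (rule LV LE)) : gts LV LE :=
  {| gts_rules := fun r => List.In r s;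
     gts_finite := ex_intro _ s (fun r => conj id id) |}.

(** Without nodes there are no edges either, as an edge has a source. The empty map is then a match,
    and since it deletes nothing the dangling condition holds. *)
Lemma empty_lhs_step r G : (node (lhs r) -> False) -> exists M, rule_step r G M.
Proof.
move=> noN; pose noE (e : edge (lhs r)) : False := noN (src e).
have [g _] : exists g : hom (lhs r) G, True.
  by unshelve eexists (@Hom _ _ (lhs r) G (fun v => match noN v with end)
    (fun e => match noE e with end) _ _ _ _ _) => // x; case: (noN x) || case: (noE x).
have m : is_match g.
  split; first by split=> [v|e]; [case: (noN v)|case: (noE e)].
  by move=> e _; split; apply/del_nodeP => -[v]; case: (noN v).
by exists (result_tlrg m); apply: rule_step_result.
Qed.

(** No class is a normal form, and choosing successors repeatedly yields an infinite sequence from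
    any class: the semantic function is constantly the singleton of bottom. *)
Lemma sem_nonterminating (T : gts LV LE) :
  (forall C, exists D, class_step T C D) -> forall x y, sem T x y <-> y = None.
Proof.
move=> tot [C|] [D|] //; first by split=> // -[_ []]; apply: tot.
split=> // _; have [next nextP] := functional_choice _ tot.
by exists (fun n => iter n next C); split.
Qed.

Lemma id_hom_inj G : injective_hom (hom_id G).
Proof. by split. Qed.

Definition id_rule G : rule LV LE :=
  {| lhs := G; itf := G; rhs := G; incL := hom_id G; incR := hom_id G;
     incL_inj := @id_hom_inj G; incR_inj := @id_hom_inj G |}.

(** Every item of L lies in the interface, so nothing is deleted or created and each matched node
    receives the label it already had. *)
Lemma id_rule_step L G M : rule_step (id_rule L) G M -> graph_iso M G.
Proof.
move=> [g [m GM]]; apply: graph_iso_trans GM _; apply: graph_iso_sym.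
have codV (v : node L) : v \in codom (hnode (hom_id L)) by exact: codom_f (hnode (hom_id L)) v.
have codE (e : edge L) : e \in codom (hedge (hom_id L)) by exact: codom_f (hedge (hom_id L)) e.
have keepV x : ~~ @del_node _ _ (id_rule L) G g x.
  by apply/del_nodeP => -[v]; rewrite codV.
have keepE x : ~~ @del_edge _ _ (id_rule L) G g x.
  by apply/del_edgeP => -[v]; rewrite codE.
have noV (w : new_node (id_rule L)) : False by have := valP w; rewrite /= codV.
have noE (w : new_edge (id_rule L)) : False by have := valP w; rewrite /= codE.
pose rN (x : node G) (y : node (result m)) : Prop :=
  match y with inl d => val d = x | inr _ => False end.
pose rE (x : edge G) (y : edge (result m)) : Prop :=
  match y with inl d => val d = x | inr _ => False end.
apply: (@graph_iso_rel _ _ _ _ rN rE).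
- split=> [x|[d|w]|x [d|w] [d'|w'] //= <- E|x x' [d|w] //= <- //].
  + by exists (inl (keep_node (keepV x))).
  + by exists (val d).
  + by case: (noV w).
  + by congr inl; apply: val_inj.
- split=> [x|[d|w]|x [d|w] [d'|w'] //= <- E|x x' [d|w] //= <- //].
  + by exists (inl (keep_edge (keepE x))).
  + by exists (val d).
  + by case: (noE w).
  + by congr inl; apply: val_inj.
- by move=> e [d|//] /= <-.
- move=> x [d|//] xd; case: (kept_nodeP d) => [[k dk]|dL].
    rewrite (result_nlab_itf m dk) (result_rooted_itf m dk).
    by rewrite -[x]xd dk /= hom_nlab_total hom_rooted_total.
  by rewrite (result_nlab_context m dL) (result_rooted_context m dL) -[x]xd.
Qed.

Definition empty_tlrg : tlrg LV LE.
Proof.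
exists {| node := void; edge := void; src := id; tgt := id;
  nlab := of_void _; elab := of_void _; rooted := of_void _ |}; by case.
Defined.

Definition empty_hom G : hom empty_tlrg G.
Proof.
by exists (of_void (node G) : node empty_tlrg -> _)
  (of_void (edge G) : edge empty_tlrg -> _); case.
Defined.

Lemma empty_hom_inj G : injective_hom (empty_hom G).
Proof. by split; case. Qed.

Definition creation_rule G : rule LV LE :=
  {| lhs := empty_tlrg; itf := empty_tlrg; rhs := G;
     incL := empty_hom empty_tlrg; incR := empty_hom G;
     incL_inj := @empty_hom_inj empty_tlrg; incR_inj := @empty_hom_inj G |}.

Lemma creation_rule_step L G M :
  rule_step (creation_rule L) G M -> node L -> inhabited (node M).
Proof.
move=> [g [m /graph_iso_sym[f _]]] v.
have vK : v \notin codom (hnode (incR (creation_rule L))) by apply/codomP => -[[]].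
by constructor; apply: (hnode f); right; exact: add_node vK.
Qed.

(** The rule applies to every graph and leaves it unchanged up to isomorphism. *)
Lemma class_step_id_empty (C D : gclass LV LE) :
  class_step (gts_of [:: id_rule empty_tlrg]) C D <-> C = D.
Proof.
split=> [[G [H [-> -> [r [<-|//] /id_rule_step GH]]]]|<-].
  exact/iso_classP/graph_iso_sym.
have [G ->] := gclassP C.
have [M GM] : exists M, rule_step (id_rule empty_tlrg) G M.
  by apply: empty_lhs_step; case.
exists G, M; split=> //; last by exists (id_rule empty_tlrg) => //; left.
exact/iso_classP/graph_iso_sym/id_rule_step/GM.
Qed.

End Examples.

(** * The three strictness examples *)

Definition point_tlrg : tlrg unit unit.
Proof.
exists {| node := unit; edge := void; src := of_void _; tgt := of_void _;
  nlab := fun=> Some tt; elab := of_void _; rooted := fun=> Some false |}; by [].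
Defined.

Lemma gts_equivN_not_iso :
  exists T1 T2 : gts unit unit, gts_equivN T1 T2 /\ ~ gts_iso T1 T2.
Proof.
pose r := id_rule point_tlrg.
exists (gts_of [:: r]), (gts_of [:: normal_form r]); split.
  have rr : rule_nequiv r (normal_form r).
    exists (hom_id _), (hom_id _), (hom_id _); split; last by split.
    by split; apply: iso_hom_id.
  apply/(same_classesP _ _ (@rule_nequiv_classP _ _)); split=> _ [<-|//].
    by exists (normal_form r) => //; left.
  by exists r; [left|apply: rule_iso_sym].
move=> /(same_classesP _ _ (@rule_iso_classP _ _))[] /(_ r (or_introl erefl)).
move=> [_ [<-|//] [_ [_ [h _]]]] _.
(* The morphism [h] would have to carry the label of the point into a bare graph, giving
   [None = Some tt]. *)
by have := @hom_nlab _ _ _ _ h tt tt erefl.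
Qed.

Lemma gts_equivS_not_equivN :
  exists T1 T2 : gts unit unit, gts_equivS T1 T2 /\ ~ gts_equivN T1 T2.
Proof.
pose r0 := id_rule (empty_tlrg unit unit); pose r1 := id_rule point_tlrg.
exists (gts_of [:: r0]), (gts_of [:: r0; r1]); split.
  move=> C D; split=> [[G [H [CG DH [r [<-|//] GH]]]]|].
    by exists G, H; split=> //; exists r0 => //; left.
  move=> [G [H [-> -> [r rT GH]]]]; apply/class_step_id_empty/iso_classP/graph_iso_sym.
  (* Either identity rule yields only steps from a class to itself, and [r0] already provides all of
     these. *)
  by case: rT GH => [<-|[<-|//]] /id_rule_step.
move=> /(same_classesP _ _ (@rule_nequiv_classP _ _))[_].
move=> /(_ r1 (or_intror (or_introl erefl))) [_ [<-|//] [f _]].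
(* [f] would map the point into the empty left-hand side of [r0]. *)
by case: (hnode f tt).
Qed.

Lemma gts_equivF_not_equivS :
  exists T1 T2 : gts unit unit, gts_equivF T1 T2 /\ ~ gts_equivS T1 T2.
Proof.
pose r0 := id_rule (empty_tlrg unit unit); pose r1 := creation_rule point_tlrg.
exists (gts_of [:: r0]), (gts_of [:: r1]); split.
  have F1 C : exists D, class_step (gts_of [:: r0]) C D.
    by exists C; apply/class_step_id_empty.
  have F2 C : exists D, class_step (gts_of [:: r1]) C D.
    have [G ->] := gclassP C.
    have [|M GM] := @empty_lhs_step _ _ r1 G; first by case.
    by exists (iso_class M), G, M; split=> //; exists r1 => //; left.
  by move=> x y; rewrite !sem_nonterminating.
(* The separating step is the loop at the empty graph: the creation rule always produces a graph
   with a node. *)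
pose C := iso_class (empty_tlrg unit unit).
move=> /(_ C C)[] /(_ (proj2 (class_step_id_empty _ _) erefl)).
move=> [G [H [_ /iso_classP/graph_iso_sym[f _] [r [<-|//] GH]]]] _.
by have [v] := creation_rule_step GH tt; case: (hnode f v).
Qed.

Theorem mainTheorem4 :
  (forall (LV LE : finType) (T1 T2 : gts LV LE),
     [/\ gts_iso T1 T2 -> gts_equivN T1 T2,
         gts_equivN T1 T2 -> gts_equivS T1 T2 &
         gts_equivS T1 T2 -> gts_equivF T1 T2]) /\
  [/\ ~ (forall (LV LE : finType) (T1 T2 : gts LV LE),
           gts_equivN T1 T2 -> gts_iso T1 T2),
      ~ (forall (LV LE : finType) (T1 T2 : gts LV LE),
           gts_equivS T1 T2 -> gts_equivN T1 T2) &
      ~ (forall (LV LE : finType) (T1 T2 : gts LV LE),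
           gts_equivF T1 T2 -> gts_equivS T1 T2)].
Proof.
split=> [LV LE T1 T2|].
  split; [exact: gts_iso_equivN|exact: gts_equivN_equivS|exact: gts_equivS_equivF].
split=> conv.
- by have [T1 [T2 [/conv]]] := gts_equivN_not_iso.
- by have [T1 [T2 [/conv]]] := gts_equivS_not_equivN.
- by have [T1 [T2 [/conv]]] := gts_equivF_not_equivS.
Qed.
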